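(* Let $\mathbb{K}$ be a field and let $L=J(P)\subseteq 2^{[m]}$ be a natural distributive lattice, where $P$ is a poset on $[m]$. Let $G$ be any graph on $[m]$ that contains the minimal graph of $P$ as a subgraph and is a subgraph of the comparability graph $\mathrm{Comp}(P)$. Then the lattice graphical model ideal equals the Hibi ideal: $I_{L,G}=I_L$ in $\mathbb{K}[p_S:S\in L]$.
   Context: Natural lattices: $L\subseteq 2^{[m]}$ is a distributive lattice if it is closed under $\cap$ and $\cup$. It is natural if $\emptyset\in L$, $[m]\in L$, and the rank of every $S\in L$ (the length of a maximal chain in $L$ from the minimum of $L$ to $S$) equals $\#S$. For a poset $P=([m],\le)$, $J(P)$ is the set of order ideals of $P$ (subsets $S\subseteq[m]$ such that $t\in S$, $s\le t$ imply $s\in S$). Every natural lattice is $J(P)$ for a poset $P$ on $[m]$. Graphs from $P$: the minimal graph of $P$ is the graph on $[m]$ whose edges are the pairs $\{i,j\}$ such that one of $i,j$ covers the other in $P$. The comparability graph $\mathrm{Comp}(P)$ is the graph on $[m]$ with an edge $\{i,j\}$ whenever $i<j$ or $i>j$ in $P$. Lattice graphical model ideal: let $G$ be a simple graph on $[m]$ containing the minimal graph. Let $\mathcal{C}(G)$ be the set of all cliques of $G$ (including $\emptyset$) and $\mathcal{C}(G)^{\max}$ the set of maximal cliques. Consider the $\mathbb{K}$-algebra homomorphisms from $\mathbb{K}[p_S:S\in L]$ given by $\phi_G: \ p_T\mapsto\prod_{S\in\mathcal{C}(G)^{\max}}a^S_{S\cap T}\in\mathbb{K}[a^S_U: S\in\mathcal{C}(G)^{\max},\,U\subseteq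 S]$ and $\psi_G:\ p_T\mapsto\prod_{S\in\mathcal{C}(G):\,S\subseteq T}c_S\in\mathbb{K}[c_S:S\in\mathcal{C}(G)]$ for $T\in L$. The lattice graphical model ideal is $I_{L,G}:=\ker\phi_G=\ker\psi_G$ (these kernels coincide). Hibi ideal: $I_L=\langle p_Sp_T-p_{S\cap T}\,p_{S\cup T}: S,T\in L\rangle\subseteq\mathbb{K}[p_S:S\in L]$. *)

(* Defs.v *)
From HB Require Import structures.
From mathcomp Require Import all_boot all_order all_algebra.
From mathcomp Require Import mpoly.

Set Implicit Arguments.
Unset Strict Implicit.
Unset Printing Implicit Defensive.

Import GRing.Theory.
Local Open Scope ring_scope.

Section Combinatorics.
Variable m : nat.
Implicit Types (L : {set {set 'I_m}}) (le G : rel 'I_m) (S T : {set 'I_m}).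

Definition distributive_lattice L : Prop :=
  forall S T, S \in L -> T \in L -> S :&: T \in L /\ S :|: T \in L.

Definition lattice_cover L S T : bool :=
  [&& S \in L, T \in L, S \proper T &
      ~~ [exists U in L, (S \proper U) && (U \proper T)]].

(* The sequence set0 :: c is a maximal chain of L from its minimum to S; its  *)
(* length is the number size c of steps.                                      *)
Definition maximal_chain L S (c : seq {set 'I_m}) : Prop :=
  path (lattice_cover L) set0 c /\ last set0 c = S.

Definition natural_lattice L : Prop :=
  [/\ distributive_lattice L, set0 \in L, setT \in L &
      forall S c, S \in L -> maximal_chain L S c -> size c = #|S| ].

(* A poset on [m] is an arbitrary order relation on 'I_m; it need not be      *)
(* compatible with the usual order of the indices.                            *)
Definition poset le : Prop := [/\ reflexive le, antisymmetric le & transitive le].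

Definition order_ideal le S : bool :=
  [forall t in S, forall s, le s t ==> (s \in S)].

Definition order_ideals le : {set {set 'I_m}} := [set S | order_ideal le S].

Definition poset_lt le (i j : 'I_m) : bool := (i != j) && le i j.

Definition poset_cover le (i j : 'I_m) : bool :=
  poset_lt le i j && ~~ [exists k, poset_lt le i k && poset_lt le k j].

Definition minimal_graph le : rel 'I_m :=
  fun i j => poset_cover le i j || poset_cover le j i.

Definition comparability_graph le : rel 'I_m :=
  fun i j => poset_lt le i j || poset_lt le j i.

Definition simple_graph G : Prop := ssrbool.symmetric G /\ irreflexive G.

Definition subgraph G H : Prop := subrel G H.

Definition clique G S : bool :=
  [forall i in S, forall j in S, (i != j) ==> G i j].

Definition max_clique G S : bool := maxset (clique G) S.

End Combinatorics.

Local Close Scope ring_scope.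

Lemma order_ideals_natural (m : nat) (le : rel 'I_m) :
  poset le -> natural_lattice (order_ideals le).
Proof.
case=> le_refl le_anti le_trans.
have idealP (S : {set 'I_m}) :
    reflect (forall t s, t \in S -> le s t -> s \in S) (S \in order_ideals le).
  rewrite inE; apply: (iffP forall_inP) => [H t s tS st | H t tS].
    by have /forallP/(_ s)/implyP := H t tS; apply.
  by apply/forallP => s; apply/implyP; apply: H.
have coverP (S T : {set 'I_m}) :
    lattice_cover (order_ideals le) S T -> #|T| = #|S|.+1.
  case/and4P => /idealP SL /idealP TL ST noU.
  have [sST [t0 t0T t0S]] := properP ST.
  pose down t := #|[set s | le s t]|.
  have t0P : (t0 \in T) && (t0 \notin S) by rewrite t0T.
  case: (@arg_minnP _ t0 (fun t => (t \in T) && (t \notin S)) down t0P)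
    => t /andP[tT tS] tmin.
  have UL : t |: S \in order_ideals le.
    apply/idealP => u s; rewrite !inE => /orP[/eqP-> st | uS su]; last first.
      by rewrite (SL u s uS su) orbT.
    apply: contraT => /norP[s_neq_t sS].
    have sP : (s \in T) && (s \notin S) by rewrite (TL t s tT st).
    have sub : [set r | le r s] \subset [set r | le r t].
      by apply/subsetP => r; rewrite !inE => rs; apply: le_trans st.
    have /eqP eq_down : [set r | le r s] == [set r | le r t].
      by rewrite eqEcard sub; apply: tmin.
    have : t \in [set r | le r s] by rewrite eq_down inE.
    rewrite inE => ts; case/eqP: s_neq_t.
    by apply: le_anti; rewrite st.
  have US : t |: S \subset T by rewrite subUset sub1set tT.
  suff -> : T = t |: S by rewrite cardsU1 tS.
  apply/eqP; rewrite eq_sym; apply: contraNT noU => U_neq_T.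
  apply/existsP; exists (t |: S); rewrite UL /=.
  by rewrite properUr ?sub1set // properEneq U_neq_T.
have chainP c : forall S : {set 'I_m},
    path (lattice_cover (order_ideals le)) S c -> #|last S c| = size c + #|S|.
  elim: c => //= T c IHc S /andP[/coverP TS /IHc ->].
  by rewrite TS addSnnS.
split.
- move=> S T /idealP SL /idealP TL; split; apply/idealP => t s; rewrite !inE.
    by case/andP => tS tT st; rewrite (SL t s) // (TL t s).
  by case/orP => tS st; rewrite ?(SL t s tS st) ?(TL t s tS st) ?orbT.
- by apply/idealP => t s; rewrite inE.
- by apply/idealP => t s; rewrite !inE.
- by move=> S c _ [/chainP + <-]; rewrite cards0 addn0.
Qed.

Local Open Scope ring_scope.

(* Polynomial ring with variables indexed by an arbitrary finite type.        *)
Definition polyring (K : fieldType) (I : finType) := {mpoly K[#|I|]}.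

Definition pvar (K : fieldType) (I : finType) (i : I) : polyring K I :=
  'X_(enum_rank i).

(* The K-algebra homomorphism out of K[I] sending the variable i to f i.      *)
Definition subst_hom (K : fieldType) (I J : finType) (f : I -> polyring K J) :
    polyring K I -> polyring K J :=
  mmap (@mpolyC #|J| K) (fun k => f (enum_val k)).

HB.instance Definition _ (K : fieldType) (I J : finType)
    (f : I -> polyring K J) :=
  GRing.RMorphism.copy (subst_hom f)
    (mmap (@mpolyC #|J| K) (fun k => f (enum_val k))).

Lemma subst_hom_var (K : fieldType) (I J : finType) (f : I -> polyring K J) i :
  subst_hom f (pvar K i) = f i.
Proof. by rewrite /subst_hom mmapX mmap1U enum_rankK. Qed.

Lemma subst_homC (K : fieldType) (I J : finType) (f : I -> polyring K J) c :
  subst_hom f c%:MP = c%:MP.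
Proof. exact: mmapC. Qed.

Definition ideal_gen (R : comNzRingType) (X : R -> Prop) (x : R) : Prop :=
  exists s : seq (R * R),
    (forall cg, cg \in s -> X cg.2) /\ x = \sum_(cg <- s) cg.1 * cg.2.

Section Ideals.
Variables (K : fieldType) (m : nat).

Definition lattice_elt (L : {set {set 'I_m}}) : finType := {S : {set 'I_m} | S \in L}.

Section GraphMaps.
Variables (L : {set {set 'I_m}}) (G : rel 'I_m).

Definition clique_elt : finType := {S : {set 'I_m} | clique G S}.
Definition max_clique_elt : finType := {S : {set 'I_m} | max_clique G S}.
Definition subset_elt (S : {set 'I_m}) : finType :=
  {U : {set 'I_m} | U \subset S}.

(* Index type of the variables a^S_U, with S a maximal clique and U \subset S *)
Definition avar_index : finType :=
  {S : max_clique_elt & subset_elt (val S)}.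

Definition avar (S : max_clique_elt) (U : subset_elt (val S)) :
    polyring K avar_index :=
  pvar K (Tagged (fun S : max_clique_elt => subset_elt (val S)) U).

Definition inter_elt (S T : {set 'I_m}) : subset_elt S :=
  exist _ (S :&: T) (subsetIl S T).

Definition phi : polyring K (lattice_elt L) -> polyring K avar_index :=
  subst_hom (fun T : lattice_elt L =>
    \prod_(S : max_clique_elt) avar (inter_elt (val S) (val T))).

Definition psi : polyring K (lattice_elt L) -> polyring K clique_elt :=
  subst_hom (fun T : lattice_elt L =>
    \prod_(S : clique_elt | val S \subset val T) pvar K S).

(* The kernel of psi is the same ideal: see ker_phi_psi.                      *)
Definition lattice_graphical_ideal (p : polyring K (lattice_elt L)) : Prop :=
  phi p = 0.

End GraphMaps.

(* U and V are the elements S :&: T and S :|: T of L.                         *)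
Definition hibi_generator (L : {set {set 'I_m}})
    (g : polyring K (lattice_elt L)) : Prop :=
  exists S T U V : lattice_elt L,
    [/\ val U = val S :&: val T, val V = val S :|: val T &
        g = pvar K S * pvar K T - pvar K U * pvar K V].

Definition hibi_ideal (L : {set {set 'I_m}}) :
    polyring K (lattice_elt L) -> Prop :=
  ideal_gen (@hibi_generator L).

End Ideals.

Section MonomialMaps.
Variables (K : fieldType) (n : nat).

Definition image_mnm k (e : 'I_n -> 'X_{1..k}) (u : 'X_{1..n}) : 'X_{1..k} :=
  (\sum_(i < n) e i *+ u i)%MM.

Lemma mmap_mnmE k (e : 'I_n -> 'X_{1..k}) (p : {mpoly K[n]}) :
  mmap (@mpolyC k K) (fun i => 'X_[e i]) p =
  \sum_(u <- msupp p) p@_u *: 'X_[image_mnm e u].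
Proof.
apply: eq_bigr => u _; rewrite mul_mpolyC; congr (_ *: _).
exact: mprodXnE.
Qed.

Lemma mmap_mnm_ker_sub k1 k2 (e1 : 'I_n -> 'X_{1..k1})
    (e2 : 'I_n -> 'X_{1..k2}) (p : {mpoly K[n]}) :
  (forall u v, image_mnm e1 u = image_mnm e1 v ->
               image_mnm e2 u = image_mnm e2 v) ->
  mmap (@mpolyC k1 K) (fun i => 'X_[e1 i]) p = 0 ->
  mmap (@mpolyC k2 K) (fun i => 'X_[e2 i]) p = 0.
Proof.
move=> e12; rewrite !mmap_mnmE; set s := msupp p => p0.
pose r := undup [seq image_mnm e1 u | u <- s].
transitivity (\sum_(w <- r) \sum_(u <- s | image_mnm e1 u == w)
   p@_u *: 'X_[image_mnm e2 u] : {mpoly K[k2]}).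
  rewrite (exchange_big_dep predT) //= [LHS]big_seq [RHS]big_seq.
  apply: eq_bigr => u us.
  rewrite big_mkcond (bigD1_seq (image_mnm e1 u)) ?undup_uniq ?mem_undup ?map_f //=.
  by rewrite eqxx big1 ?addr0 // => w; rewrite eq_sym => /negbTE->.
rewrite big_seq big1 // => w; rewrite mem_undup => /mapP[u0 _ ->].
rewrite (eq_bigr (fun u => p@_u *: 'X_[image_mnm e2 u0])); last first.
  by move=> u /eqP/e12->.
rewrite -scaler_suml; have /(congr1 (mcoeff (image_mnm e1 u0))) := p0.
rewrite mcoeff0 raddf_sum /= => p0w; rewrite big_mkcond /=.
rewrite -[RHS](scale0r ('X_[image_mnm e2 u0] : {mpoly K[k2]})).
congr (_ *: _); rewrite -[RHS]p0w.
apply: eq_bigr => u _; rewrite mcoeffZ mcoeffX.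
by case: eqP => _; rewrite ?mulr1 ?mulr0.
Qed.

End MonomialMaps.

Section KernelsCoincide.
Variables (K : fieldType) (m : nat).
Variables (L : {set {set 'I_m}}) (G : rel 'I_m).

Local Notation nL := #|lattice_elt L|.
Local Notation elt i := (val (enum_val i : lattice_elt L)).

Definition phi_mnm (i : 'I_nL) : 'X_{1..#|avar_index G|} :=
  (\sum_(S : max_clique_elt G)
     U_(enum_rank (Tagged (fun S : max_clique_elt G => subset_elt (val S))
                          (inter_elt (val S) (elt i)))))%MM.

Definition psi_mnm (i : 'I_nL) : 'X_{1..#|clique_elt G|} :=
  (\sum_(S : clique_elt G | val S \subset elt i) U_(enum_rank S))%MM.

Lemma phiE p : @phi K m L G p = mmap (@mpolyC _ K) (fun i => 'X_[phi_mnm i]) p.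
Proof.
apply: eq_bigr => u _; congr (_ * _); apply: mmap1_eq => i.
exact: mprodXE.
Qed.

Lemma psiE p : @psi K m L G p = mmap (@mpolyC _ K) (fun i => 'X_[psi_mnm i]) p.
Proof.
apply: eq_bigr => u _; congr (_ * _); apply: mmap1_eq => i.
exact: mprodXE.
Qed.

Lemma phi_mnmE (u : 'X_{1..nL}) (S : max_clique_elt G) (U : subset_elt (val S)) :
  image_mnm phi_mnm u
    (enum_rank (Tagged (fun S : max_clique_elt G => subset_elt (val S)) U)) =
  (\sum_(i < nL) (val S :&: elt i == val U) * u i)%N.
Proof.
rewrite mnm_sumE; apply: eq_bigr => i _; rewrite mulmnE; congr (_ * _)%N.
rewrite mnm_sumE (bigD1 S) //= mnm1E (inj_eq enum_rank_inj) eq_Tagged /=.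
rewrite big1 ?addn0 => [|S' neqS]; first by rewrite -val_eqE.
by rewrite mnm1E (inj_eq enum_rank_inj) -tag_eqE /tag_eq /= (negbTE neqS).
Qed.

Lemma psi_mnmE (u : 'X_{1..nL}) (C : clique_elt G) :
  image_mnm psi_mnm u (enum_rank C) =
  (\sum_(i < nL) (val C \subset elt i) * u i)%N.
Proof.
rewrite mnm_sumE; apply: eq_bigr => i _; rewrite mulmnE; congr (_ * _)%N.
rewrite mnm_sumE big_mkcond (bigD1 C) //= big1 ?addn0 => [|C' neqC].
  by case: ifP; rewrite ?mnm0E // mnm1E eqxx.
by case: ifP; rewrite ?mnm0E // mnm1E (inj_eq enum_rank_inj) (negbTE neqC).
Qed.

Lemma count_split (u : 'X_{1..nL}) (S C : {set 'I_m}) : C \subset S ->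
  (\sum_(i < nL) (C \subset elt i) * u i =
   \sum_(U : {set 'I_m} | (C \subset U) && (U \subset S))
     \sum_(i < nL) (S :&: elt i == U) * u i)%N.
Proof.
move=> CS; rewrite exchange_big /=; apply: eq_bigr => i _.
rewrite -big_distrl; congr (_ * _)%N; rewrite big_mkcond /=.
rewrite (bigD1 (S :&: elt i)) //= subsetIl andbT subsetI CS eqxx big1 ?addn0.
  by case: (_ \subset _).
by move=> U; rewrite eq_sym => /negbTE->; rewrite if_same.
Qed.

Lemma sub_clique (S U : {set 'I_m}) : U \subset S -> clique G S -> clique G U.
Proof.
move=> /subsetP US /forall_inP cS; apply/forall_inP => i /US/cS/forall_inP cSi.
by apply/forall_inP => j /US/cSi.
Qed.

Lemma ker_phi_psi (p : polyring K (lattice_elt L)) :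
  phi G p = 0 <-> psi G p = 0.
Proof.
rewrite phiE psiE; split; apply: mmap_mnm_ker_sub => u v uv.
  apply/mnmP => j; rewrite -(enum_valK j); case: (enum_val j) => C cC.
  rewrite !psi_mnmE /=.
  have [S maxS CS] := maxset_exists cC.
  rewrite !(count_split _ CS); apply: eq_bigr => U /andP[_ US].
  have := congr1 (fun w : 'X_{1..#|avar_index G|} => w (enum_rank
    (Tagged (fun S : max_clique_elt G => subset_elt (val S))
       (exist _ U US : subset_elt (val (exist _ S maxS : max_clique_elt G)))))) uv.
  by rewrite /= !phi_mnmE.
apply/mnmP => j; rewrite -(enum_valK j); case: (enum_val j) => -[S maxS] [U US].
rewrite -[existT _ _ _]/(Tagged (fun S : max_clique_elt G => subset_elt (val S))
  (exist _ U US : subset_elt (val (exist _ S maxS : max_clique_elt G)))).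
rewrite !phi_mnmE /= {j}.
have cS : clique G S by exact: maxsetp maxS.
have [k] := ubnP (#|S| - #|U|); elim: k U US => // k IHk U US ltk.
have := congr1 (fun w : 'X_{1..#|clique_elt G|} =>
  w (enum_rank (exist _ U (sub_clique US cS) : clique_elt G))) uv.
rewrite /= !psi_mnmE /= !(count_split _ US).
rewrite (bigD1 U) ?subxx //= [RHS](bigD1 U) ?subxx //=.
rewrite [X in (_ + X)%N](eq_bigr (fun V =>
  (\sum_(i < nL) (S :&: elt i == V) * v i)%N)).
  by move/addIn.
move=> V /andP[/andP[UV VS] neqUV]; apply: IHk => //.
rewrite -ltnS; apply: leq_trans ltk; rewrite ltnS ltn_sub2l //.
  by apply: proper_card; rewrite properE US; apply: contra neqUV => SU;
     rewrite eqEsubset UV (subset_trans VS).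
by apply: proper_card; rewrite properEneq eq_sym neqUV.
Qed.

End KernelsCoincide.

(* Main.v *)
Require Import Defs.
From HB Require Import structures.
From mathcomp Require Import all_boot all_order all_algebra.
From mathcomp Require Import mpoly.

(**
  Hibi binomials lie in the kernel because a clique of [G] is a chain of [P]:
  if it is contained in the union of two order ideals, it is contained in one
  of them.  Conversely, modulo the Hibi ideal every product of variables can be
  straightened to the product along a multichain [S_1 :>: S_2 :>: ...].  The
  multichain is determined by its length and by the number of its members
  containing each given point, and these are the exponents of [c_S] in the
  image under [psi] for [S] the empty clique and the singleton cliques.  So two
  monomials with the same image are congruent, and the kernel of a monomial map
  is spanned by differences of such monomials.
*)

Set Implicit Arguments.
Unset Strict Implicit.
Unset Printing Implicit Defensive.

Import GRing.Theory.
Local Open Scope ring_scope.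

(** * Generated ideals and kernels of monomial maps *)

Section IdealGen.
Variables (R : comNzRingType) (X : R -> Prop).
Implicit Types x y z : R.

Lemma ideal_gen_mem x : X x -> ideal_gen X x.
Proof.
move=> Xx; exists [:: (1, x)]; split; last by rewrite big_seq1 mul1r.
by move=> cg; rewrite inE => /eqP->.
Qed.

Lemma ideal_gen0 : ideal_gen X 0.
Proof. by exists [::]; rewrite big_nil. Qed.

Lemma ideal_genD x y : ideal_gen X x -> ideal_gen X y -> ideal_gen X (x + y).
Proof.
move=> [s [sX ->]] [t [tX ->]]; exists (s ++ t); rewrite big_cat; split=> // cg.
by rewrite mem_cat => /orP[/sX|/tX].
Qed.

Lemma ideal_genMl z x : ideal_gen X x -> ideal_gen X (z * x).
Proof.
move=> [s [sX ->]]; exists [seq (z * cg.1, cg.2) | cg <- s]; split.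
  by move=> _ /mapP[cg /sX ? ->].
by rewrite big_map mulr_sumr; apply: eq_bigr => cg _; rewrite mulrA.
Qed.

Lemma ideal_gen_sum (I : eqType) (r : seq I) (F : I -> R) :
  (forall i, i \in r -> ideal_gen X (F i)) -> ideal_gen X (\sum_(i <- r) F i).
Proof.
move=> rF; rewrite big_seq; elim/big_ind: _ => [|x y|i /rF//].
  exact: ideal_gen0.
exact: ideal_genD.
Qed.

Lemma ideal_gen_trans y x z :
  ideal_gen X (x - y) -> ideal_gen X (y - z) -> ideal_gen X (x - z).
Proof. by move=> /ideal_genD /[apply]; rewrite addrA subrK. Qed.

Lemma ideal_gen_sym x y : ideal_gen X (x - y) -> ideal_gen X (y - x).
Proof. by move=> /(ideal_genMl (-1)); rewrite mulN1r opprB. Qed.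

End IdealGen.

(** Replacing each monomial of [p] by a fixed representative of its fibre under [image_mnm e]
    changes [p] by multiples of the given differences, and leaves zero. *)
Lemma mmap_mnm_ker_ideal (K : fieldType) (n k : nat) (e : 'I_n -> 'X_{1..k})
    (X : {mpoly K[n]} -> Prop) (p : {mpoly K[n]}) :
  (forall u v, image_mnm e u = image_mnm e v ->
     ideal_gen X ('X_[u] - 'X_[v])) ->
  mmap (@mpolyC k K) (fun i => 'X_[e i]) p = 0 -> ideal_gen X p.
Proof.
move=> eX; rewrite mmap_mnmE; set s := msupp p => p0.
(* The representative is the first monomial of the support over [w]; the default [0%MM] is never
   reached for [w] in the image of [s]. *)
pose rep w := nth 0%MM s (find (fun u => image_mnm e u == w) s).
have repP u : u \in s -> image_mnm e (rep (image_mnm e u)) = image_mnm e u.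
  move=> us; apply/eqP; apply: (@nth_find _ _ (fun v => _ v == _)).
  by apply/hasP; exists u.
(* Grouped by fibre, the coefficient of [rep w] is the coefficient of ['X_[w]] in the image of [p],
   which vanishes. *)
have rep0 : \sum_(u <- s) p@_u *: 'X_[rep (image_mnm e u)] = 0 :> {mpoly K[n]}.
  pose r := undup [seq image_mnm e u | u <- s].
  transitivity (\sum_(w <- r) (\sum_(u <- s | image_mnm e u == w) p@_u)
     *: 'X_[rep w] : {mpoly K[n]}).
    under [RHS]eq_bigr do rewrite scaler_suml.
    rewrite (exchange_big_dep predT) //= [LHS]big_seq [RHS]big_seq.
    apply: eq_bigr => u us.
    rewrite big_mkcond (bigD1_seq (image_mnm e u)) ?undup_uniq ?mem_undup
      ?map_f //=.
    by rewrite eqxx big1 ?addr0 // => w; rewrite eq_sym => /negbTE->.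
  rewrite big1 // => w _; have /(congr1 (mcoeff w)) := p0.
  rewrite mcoeff0 raddf_sum /= => p0w; rewrite big_mkcond /=.
  rewrite -[RHS](scale0r ('X_[rep w] : {mpoly K[n]})); congr (_ *: _).
  rewrite -[RHS]p0w; apply: eq_bigr => u _; rewrite mcoeffZ mcoeffX.
  by case: eqP => _; rewrite ?mulr1 ?mulr0.
rewrite -[p]subr0 -rep0 {1}[p]mpolyE -sumrB; apply: ideal_gen_sum => u us.
rewrite -scalerBr -mul_mpolyC; apply: ideal_genMl; apply: eX.
by rewrite repP.
Qed.

(** * Straightening sequences of lattice elements into multichains *)

Section Multichains.
Variables (m : nat) (L : {set {set 'I_m}}) (distL : distributive_lattice L).
Implicit Types (S T : lattice_elt L) (c s : seq (lattice_elt L)).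

Definition lmeet S T : lattice_elt L :=
  exist _ (val S :&: val T) (distL (valP S) (valP T)).1.

Definition ljoin S T : lattice_elt L :=
  exist _ (val S :|: val T) (distL (valP S) (valP T)).2.

Definition lsup S T : bool := val T \subset val S.

(** The join stays in place and the meet is carried down the chain, so that each step is one Hibi
    relation. *)
Fixpoint chain_insert T c : seq (lattice_elt L) :=
  if c is A :: c' then ljoin T A :: chain_insert (lmeet T A) c' else [:: T].

Definition straighten s := foldr chain_insert [::] s.

Definition mult (i : 'I_m) s := count (fun S => i \in val S) s.

Lemma lsup_trans : transitive lsup.
Proof. by move=> T S U ST TU; apply: subset_trans ST. Qed.

Lemma size_straighten s : size (straighten s) = size s.
Proof.
elim: s => //= T s <-; elim: (straighten s) T => //= S c IHc T.
by rewrite IHc.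
Qed.

(** A point lies in as many of the two sets [T], [S] as of their join and meet. *)
Lemma mult_straighten i s : mult i (straighten s) = mult i s.
Proof.
elim: s => //= T s <-; elim: (straighten s) T => //= S c IHc T.
rewrite /mult /= in IHc *; rewrite IHc /= !inE.
by case: (i \in val T); case: (i \in val S); rewrite ?addnA.
Qed.

(** The join of two subsets of [A] stays inside [A], the carried meet lies inside that join, and
    enlarging the head [S] to the join keeps the tail decreasing. *)
Lemma path_chain_insert A T c :
  lsup A T -> path lsup A c -> path lsup A (chain_insert T c).
Proof.
elim: c A T => /= [|S c IHc] A T AT; first by rewrite AT.
case/andP=> AS Sc; rewrite {1}/lsup subUset; apply/andP; split.
  by apply/andP.
have joinS : lsup (ljoin T S) S by apply: subsetUr.
apply: IHc; first exact: subset_trans (subsetIr _ _) joinS.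
by apply: (path_le lsup_trans) Sc.
Qed.

Lemma straighten_sorted s : sorted lsup (straighten s).
Proof.
elim: s => //= T s; case: (straighten s) => //= S c Sc.
have joinS : lsup (ljoin T S) S by apply: subsetUr.
apply: path_chain_insert; first exact: subset_trans (subsetIr _ _) joinS.
by apply: (path_le lsup_trans) Sc.
Qed.

(** The head contains all other members, so it consists of the points of positive multiplicity; it
    is removed and the argument repeated. The length accounts for empty members, which [mult] does
    not see. *)
Lemma multichain_eq c1 c2 :
    sorted lsup c1 -> sorted lsup c2 -> size c1 = size c2 ->
  (forall i, mult i c1 = mult i c2) -> c1 = c2.
Proof.
have headP S c i : path lsup S c -> (i \in val S) = (0 < mult i (S :: c))%N.
  move=> Sc; rewrite /mult /=; case: (boolP (i \in _)) => //= iS.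
  apply/esym/negbTE; rewrite -eqn0Ngt -leqn0 leqNgt -has_count.
  apply: contra iS => /hasP[T Tc iT].
  by move/(order_path_min lsup_trans)/allP/(_ T Tc)/subsetP: Sc; apply.
elim: c1 c2 => [|S1 c1 IHc] [|S2 c2] //= Sc1 Sc2 [eq_size] eq_mult.
have eqS : S1 = S2.
  apply/val_inj/setP => i; rewrite (headP _ c1) // (headP _ c2) //.
  by congr (_ < _)%N; apply: eq_mult.
rewrite -eqS in Sc2 eq_mult *; congr (_ :: _).
apply: IHc; rewrite ?(path_sorted Sc1) ?(path_sorted Sc2) // => i.
by have /addnI := eq_mult i.
Qed.

Lemma straighten_eq s t : size s = size t -> (forall i, mult i s = mult i t) ->
  straighten s = straighten t.
Proof.
move=> size_st mult_st; apply: multichain_eq; rewrite ?straighten_sorted //.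
  by rewrite !size_straighten.
by move=> i; rewrite !mult_straighten.
Qed.

(** * Straightening modulo the Hibi ideal *)

Variable K : fieldType.

Lemma prod_straighten s :
  hibi_ideal (\prod_(T <- s) pvar K T - \prod_(T <- straighten s) pvar K T).
Proof.
elim: s => [|T s IHs] /=; first by rewrite subrr; apply: ideal_gen0.
rewrite big_cons; apply: (@ideal_gen_trans _ _
  (pvar K T * \prod_(U <- straighten s) pvar K U)).
  by rewrite -mulrBr; apply: ideal_genMl.
elim: (straighten s) T => {IHs} /= [|S c IHc] T.
  by rewrite big_nil big_seq1 mulr1 subrr; apply: ideal_gen0.
(* A single generator trades [T], [S] for their join and meet; induction then inserts the meet into
   [c]. *)
rewrite !big_cons; apply: (@ideal_gen_trans _ _ (pvar K (ljoin T S) *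
  (pvar K (lmeet T S) * \prod_(U <- c) pvar K U))).
  rewrite !mulrA -mulrBl mulrC [pvar K (ljoin T S) * _]mulrC.
  apply: ideal_genMl; apply: ideal_gen_mem.
  by exists T, S, (lmeet T S), (ljoin T S).
by rewrite -mulrBr; apply: ideal_genMl.
Qed.

Definition mnm_seq (u : 'X_{1..#|lattice_elt L|}) : seq (lattice_elt L) :=
  flatten [seq nseq (u i) (enum_val i) | i <- enum 'I_#|lattice_elt L|].

Lemma prod_mnm_seq u : \prod_(T <- mnm_seq u) pvar K T = 'X_[u].
Proof.
rewrite big_flatten big_map big_enum mpolyXE_id; apply: eq_bigr => i _ /=.
by rewrite big_nseq iter_mulr_1 /pvar enum_valK.
Qed.

Lemma count_mnm_seq u a :
  count a (mnm_seq u) = (\sum_i a (enum_val i) * u i)%N.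
Proof.
rewrite count_flatten -map_comp sumnE big_map big_enum.
by apply: eq_bigr => i _ /=; rewrite count_nseq.
Qed.

Lemma hibi_of_image_eq (G : rel 'I_m) u v :
  image_mnm (@psi_mnm m L G) u = image_mnm (@psi_mnm m L G) v ->
  @hibi_ideal K m L ('X_[u] - 'X_[v]).
Proof.
(* The exponent of [c_C] in the image under [psi] counts the factors that contain [C]. *)
move=> uv; have count_eq (C : clique_elt G) :
    count (fun T : lattice_elt L => val C \subset val T) (mnm_seq u) =
    count (fun T : lattice_elt L => val C \subset val T) (mnm_seq v).
  by rewrite !count_mnm_seq -!psi_mnmE uv.
have clique0 : clique G set0 by apply/forall_inP => i; rewrite inE.
have clique1 i : clique G [set i].
  apply/forall_inP => j /set1P->; apply/forall_inP => k /set1P->.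
  by rewrite eqxx.
have straight_eq : straighten (mnm_seq u) = straighten (mnm_seq v).
  apply: straighten_eq => [|i].
    have /= := count_eq (exist _ set0 clique0).
    by rewrite !(@eq_count _ _ predT) ?count_predT // => T; rewrite /= sub0set.
  have mem1 : (fun T : lattice_elt L => [set i] \subset val T) =1
              (fun T : lattice_elt L => i \in val T).
    by move=> T; rewrite sub1set.
  rewrite /mult -!(eq_count mem1).
  exact: (count_eq (exist _ [set i] (clique1 i))).
rewrite -!prod_mnm_seq.
apply: ideal_gen_trans (prod_straighten _) _; rewrite straight_eq.
exact: ideal_gen_sym (prod_straighten _).
Qed.

End Multichains.

(** * Hibi binomials in the kernel, and equality of the two ideals *)

Lemma psi_hibi_generator (K : fieldType) (m : nat) (le G : rel 'I_m)
    (g : polyring K (lattice_elt (order_ideals le))) :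
  subgraph G (comparability_graph le) -> hibi_generator g -> psi G g = 0.
Proof.
move=> G_comp [S [T [U [V [US VS ->]]]]].
have idealP (A : lattice_elt (order_ideals le)) s t :
    t \in val A -> le s t -> s \in val A.
  have := valP A; rewrite inE => /forall_inP idA /idA /forallP /(_ s).
  by move/implyP.
rewrite /psi rmorphB !rmorphM /= !subst_hom_var; apply/eqP; rewrite subr_eq0.
(* With missing factors written as 1, all products run over all cliques and are compared clique by
   clique. *)
rewrite [X in X * _]big_mkcond [X in _ * X]big_mkcond /= -big_split /=.
rewrite [X in _ == X * _]big_mkcond [X in _ == _ * X]big_mkcond -big_split /=.
apply/eqP; apply: eq_bigr => C _; rewrite US VS subsetI.
have -> : (val C \subset val S :|: val T) =
    (val C \subset val S) || (val C \subset val T).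
  apply/idP/orP => [CST | [] CA]; last 2 first.
  - exact: subset_trans CA (subsetUl _ _).
  - exact: subset_trans CA (subsetUr _ _).
  case: (boolP (_ \subset val S)) => [|/subsetPn[x xC xS]]; first by left.
  right; apply/subsetP => y yC; apply: contraR xS => yT.
  (* Here [x] is in [T] only and [y] in [S] only. They are comparable, being in a clique; the
     smaller one then lies in both ideals, a contradiction. *)
  have [/setUP[] // xT /setUP[yS | yT']] := (subsetP CST x xC, subsetP CST y yC);
    last by rewrite yT' in yT.
  have neq_xy : x != y by apply: contraNneq yT => <-.
  have /forall_inP/(_ x xC)/forall_inP/(_ y yC)/implyP/(_ neq_xy) := valP C.
  case/G_comp/orP => /andP[_ le_xy]; first exact: idealP yS le_xy.
  by rewrite (idealP T y x) in yT.
by case: (_ \subset val S); case: (_ \subset val T);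
  rewrite ?mulr1 ?mul1r.
Qed.

Theorem theorem7p7 (K : fieldType) (m : nat) (le : rel 'I_m)
    (L : {set {set 'I_m}}) (G : rel 'I_m)
    (le_poset : poset le)
    (L_natural : natural_lattice L)
    (L_ideals : L = order_ideals le)
    (G_simple : simple_graph G)
    (min_sub_G : subgraph (minimal_graph le) G)
    (G_sub_comp : subgraph G (comparability_graph le)) :
  forall p : polyring K (lattice_elt L),
    lattice_graphical_ideal G p <-> hibi_ideal p.
Proof.
(* The kernel of [psi] is used instead, because its exponents are counts of factors containing a
   clique. *)
move=> p; rewrite /lattice_graphical_ideal ker_phi_psi; split.
  have [distL _ _ _] := L_natural; rewrite psiE.
  by apply: mmap_mnm_ker_ideal => u v; apply: hibi_of_image_eq.
subst L => -[s [sX ->]]; rewrite /psi rmorph_sum big_seq big1 // => cg /sX gX.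
by rewrite rmorphM -[X in _ * X]/(psi G cg.2) (psi_hibi_generator G_sub_comp gX)
  mulr0.
Qed.
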